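(* Let $f:\mathbb{R}^+\to\mathbb{C}$, $f(x):=e^{2\pi i\omega x}$, with $\omega\in\mathbb{R}\setminus\{0\}$, and fix $\beta\in(0,1/2)$. Let $T_\beta$ be the $\alpha(\beta)$-Farey map transported to $\mathbb{R}^+$ (defined in the context). Then, for Lebesgue-a.e. $x\in\mathbb{R}^+$, $$\lim_{n\to\infty}\frac1n\sum_{i=0}^{n-1}f\circ T_\beta^i(x)=0 .$$
   Context: For $\beta\in(0,1/2)$ put $t_k:=k^{-\beta}$ for $k\ge1$, $a_k:=t_k-t_{k+1}$, $A_k:=(t_{k+1},t_k]$ (so $\{A_k\}_{k\ge1}$ partitions $(0,1]$), $\tau_0:=0$ and $\tau_k:=\sum_{j=1}^k t_j$ for $k\ge1$. Define $$\Phi(x):=\int_x^1\sum_{k\ge1}\frac{t_k}{a_k}1_{A_k}(\xi)\,d\xi,\qquad x\in(0,1),$$ so that $\Phi$ is the decreasing piecewise-linear function given by $\Phi(x)=\tau_{k-1}+\frac{t_k}{a_k}(t_k-x)$ for $x\in A_k$. Set $L_k:=[\tau_k,\tau_{k+1})$ for $k\ge0$ (so $L_0=[0,1)$, and the $L_k$ partition $[0,\infty)$). The map $T_\beta:\mathbb{R}^+\to\mathbb{R}^+$ is $$T_\beta(x)=\begin{cases}\Phi(x), & x\in L_0,\\[2pt] \dfrac{t_k}{t_{k+1}}(x-\tau_k)+\tau_{k-1}, & x\in L_k,\ k\ge1.\end{cases}$$ $T_\beta$ is defined up to a countable (hence Lebesgue-null) set: $\Phi(0)$ is infinite, so the value of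 $T_\beta$ at $x=0$ may be assigned arbitrarily, which affects the orbits of only countably many points. $T_\beta$ preserves the Lebesgue measure on $\mathbb{R}^+$. Equivalently $T_\beta=\Phi\circ F\circ\Phi^{-1}$ where $F$ is the $\alpha(\beta)$-Farey map: $F(x)=(1-x)/a_1$ on $A_1$, $F(x)=a_{k-1}(x-t_{k+1})/a_k+t_k$ on $A_k$ for $k\ge2$, $F(0)=0$. *)

(* Defs.v *)
From HB Require Import structures.
From mathcomp Require Import all_boot all_order all_algebra.
From mathcomp Require Import all_classical all_reals all_analysis.
From mathcomp Require Import complex.

Set Implicit Arguments.
Unset Strict Implicit.
Unset Printing Implicit Defensive.

Import Order.TTheory GRing.Theory Num.Theory.
Import numFieldNormedType.Exports.

Local Open Scope classical_set_scope.
Local Open Scope ring_scope.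
Local Open Scope complex_scope.

Section FareyMap.
Context {R : realType}.
Variable beta : R.

Definition t_ (k : nat) : R := k%:R `^ (- beta).

Definition a_ (k : nat) : R := t_ k - t_ k.+1.

Definition A_ (k : nat) : set R := `]t_ k.+1, t_ k]%classic.

Definition tau_ (k : nat) : R := \sum_(1 <= j < k.+1) t_ j.

Definition L_ (k : nat) : set R := `[tau_ k, tau_ k.+1[%classic.

(* The integral is finite for 0 < x < 1; it diverges at x = 0, where [fine]
   returns a meaningless value that [Tbeta] does not use. *)
Definition Phi (x : R) : R :=
  fine (\int[lebesgue_measure]_(xi in `[x, 1%R])
          \sum_(1 <= k <oo) (t_ k / a_ k * \1_(A_ k) xi)%R%:E)%E.

(* The index k with x in L_ k, which is unique for x >= 0. *)
Definition Lindex (x : R) : nat := xget 0%N [set k | L_ k x].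

(* [v] is the arbitrary value of the map at 0.  Only the values at x >= 0 are
   meaningful. *)
Definition Tbeta (v x : R) : R :=
  if x == 0 then v else
  if Lindex x is k.+1 then
    t_ k.+1 / t_ k.+2 * (x - tau_ k.+1) + tau_ k
  else Phi x.

End FareyMap.

Section Exponential.
Context {R : realType}.

Definition cexp (z : R[i]) : R[i] :=
  (expR (complex.Re z))%:C * (cos (complex.Im z) +i* sin (complex.Im z)).

Definition wave (omega x : R) : R[i] :=
  cexp (2 * (pi : R)%:C * (0 +i* 1) * omega%:C * x%:C).

(* [R[i]^o] is [R[i]] with the topology of its modulus. *)
Definition birkhoff_avg (T : R -> R) (f : R -> R[i]) (x : R) (n : nat)
    : R[i]^o :=
  n%:R^-1 * \sum_(0 <= i < n) f (iter i T x).

End Exponential.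

(* Main.v *)
Require Import Defs.
From HB Require Import structures.
From mathcomp Require Import all_boot all_order all_algebra.
From mathcomp Require Import all_classical all_reals all_analysis.
From mathcomp Require Import measurable_realfun.
From mathcomp Require Import complex.
From mathcomp Require Import ring lra.
From mathcomp Require Import zify.

Set Implicit Arguments.
Unset Strict Implicit.
Unset Printing Implicit Defensive.

Import Order.TTheory GRing.Theory Num.Theory.
Import numFieldNormedType.Exports.

Local Open Scope classical_set_scope.
Local Open Scope ring_scope.
Local Open Scope complex_scope.

(** In tower coordinates $(i, y)$, $y \in [0, 1)$, standing for the point
    $\tau_i + t_{i+1} y$ of $L_i$, the map is a renewal process: it sends
    $(i + 1, y)$ to $(i, y)$, and a point $x \in A_{k+1}$ of $(0, 1)$, which is
    $(0, x)$, to $(k, y)$, where $y$ is the image of $x$ under the affine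
    bijection from $A_{k+1}$ onto $[0, 1)$ ([Tbeta_tower], [Tbeta_base]). So an
    orbit consists of descents of the tower, the base points of successive
    descents being related by a return map with full affine branches. This
    return map preserves Lebesgue measure on $[0, 1)$, and the heights of the
    descents are independent, with $P(h + 1 \ge n) = t_n = n^{-\beta}$.

    Two facts make the averages vanish. First, along a descent of length $k$
    the phase moves by steps that vary like $j^{-\beta}$, so that the terms of
    the Birkhoff sum cancel up to $O(k^\beta)$ ([kusmin_landau],
    [excursion_sum]), even if the descent is interrupted. Secondly, the lengths
    have infinite mean: among the first $N$ descents the largest $k^\beta$ is
    about $N$, so the Birkhoff sum after $N$ descents is at most about
    $N \cdot N$, whereas the elapsed time is about $N^{1/\beta}$, and
    $1/\beta > 2$.

    To make this rigorous up to a null set it suffices to look at the scales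
    $N = Q^m$, with $Q^2 < Q w < D < Q^{1/\beta}$ ([scales_exist]). By
    Borel-Cantelli, for almost every base point and all large $m$, none of the
    first $Q^{m+1}$ base points is below $w^{-m}$, which bounds each descent's
    contribution by $C w^m$ ([negligible_small_returns]), and one of the first
    $Q^m$ descents takes at least $D^m$ steps ([negligible_short_excursions]).
    Hence averages at scale $m$ are $O((Q w / D)^m)$ ([birkhoff_avg_cvg0]). The
    exceptional base points form a null set, and so do the points of the
    countably many floors that lie above them. *)

(** * Points of the unit circle *)

Section UnitCircle.
Context {R : realType}.
Implicit Types a b u : R.

Lemma le_of_derive_ge0 (f df : R -> R) b :
  (forall x : R, is_derive x (1 : R) f (df x)) -> (forall x, 0 <= x <= b -> 0 <= df x) ->
  forall x, 0 <= x <= b -> f 0 <= f x.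
Proof.
move=> fdf df0 x /andP[]; rewrite le_eqVlt => /predU1P[<-//|x0] xb.
have [|c] := @MVT R f df 0 x x0 (fun y _ => fdf y).
  apply: continuous_subspaceT => y.
  exact/differentiable_continuous/derivable1_diffP/(@ex_derive _ _ _ _ _ _ _ (fdf y)).
rewrite in_itv /= => /andP[c0 cx] fE.
rewrite -subr_ge0 fE subr0 mulr_ge0 ?(ltW x0)//.
by apply: df0; rewrite ltW// (le_trans (ltW cx)).
Qed.

Lemma sin_le u : 0 <= u -> sin u <= u.
Proof.
move=> u0; rewrite -subr_ge0.
have := @le_of_derive_ge0 (fun x => x - sin x) (fun x => 1 - cos x) u.
rewrite sin0 subr0; apply; last by rewrite u0 lexx.
by move=> x _; rewrite subr_ge0 cos_le1.
Qed.

Lemma cos_ge_quadratic u : 1 - u ^+ 2 / 2 <= cos u.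
Proof.
wlog u0 : u / 0 <= u.
  by move=> H; have [/H//|/ltW u0] := leP 0 u; rewrite -cosN -sqrrN H// oppr_ge0.
have := @le_of_derive_ge0 (fun x => cos x + x ^+ 2 / 2) (fun x => - sin x + x) u.
rewrite cos0 expr0n /= mul0r addr0 => H.
rewrite lerBlDr; apply: H; last by rewrite u0 lexx.
- move=> x; apply: is_derive_eq.
  rewrite /GRing.scale /=; lra.
- by move=> x /andP[x0 _]; rewrite addrC subr_ge0 sin_le.
Qed.

Lemma cos_le_quadratic u : `|u| <= 1 -> cos u <= 1 - u ^+ 2 / 8.
Proof.
wlog u0 : u / 0 <= u.
  move=> H; have [/H//|/ltW u0] := leP 0 u.
  by rewrite -cosN -sqrrN -normrN; apply: H; rewrite oppr_ge0.
rewrite ger0_norm// => u1.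
have sin_ge (x : R) : 0 <= x <= 1 -> x / 4 <= sin x.
  move=> x01.
  have := @le_of_derive_ge0 (fun x => sin x - x / 4) (fun x => cos x - 4^-1) 1.
  rewrite sin0 mul0r subr0 => H; rewrite -subr_ge0. apply: H => //.
    by move=> y; apply: is_derive_eq; rewrite /GRing.scale /=; lra.
  move=> y /andP[y0 y1]; have := cos_ge_quadratic y.
  have : y ^+ 2 <= 1 by rewrite expr_le1.
  lra.
have := @le_of_derive_ge0 (fun x => - cos x - x ^+ 2 / 8)
  (fun x => sin x - x / 4) 1.
rewrite cos0 expr0n /= mul0r subr0 => H.
suff : -1 <= - cos u - u ^+ 2 / 8 by lra.
apply: H; last by rewrite u0.
- move=> x; apply: is_derive_eq.
  rewrite /GRing.scale /=; lra.
- by move=> x x01; rewrite subr_ge0 sin_ge.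
Qed.

Lemma norm_normc (z : R[i]) : `|z| = (Normc.normc z)%:C.
Proof. by case: z => a b; rewrite normc_def. Qed.

Definition unit_arg a : R[i] := cos a +i* sin a.

Lemma unit_argD a b : unit_arg (a + b) = unit_arg a * unit_arg b.
Proof.
rewrite /unit_arg cosD sinD; simpc.
by congr (_ +i* _); rewrite [RHS]addrC.
Qed.

Lemma normc_unit_arg a : Normc.normc (unit_arg a) = 1.
Proof. by rewrite /= cos2Dsin2 sqrtr1. Qed.

Lemma normc_unit_argB1 a :
  Normc.normc (unit_arg a - 1) = Num.sqrt (2 - 2 * cos a).
Proof.
rewrite /unit_arg /= subr0; congr Num.sqrt.
by have := cos2Dsin2 a; lra.
Qed.

Lemma normc_unit_argB1_ge a : `|a| <= 1 ->
  `|a| / 2 <= Normc.normc (unit_arg a - 1).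
Proof.
move=> a1; rewrite normc_unit_argB1.
have -> : `|a| / 2 = Num.sqrt ((`|a| / 2) ^+ 2).
  by rewrite sqrtr_sqr [RHS]ger0_norm// divr_ge0.
rewrite ler_sqrt.
  rewrite exprMn real_normK ?num_real//; have := cos_le_quadratic a1; lra.
have := cos_le1 a; lra.
Qed.

Lemma normc_unit_argB a b :
  Normc.normc (unit_arg a - unit_arg b) <= `|a - b|.
Proof.
have -> : unit_arg a - unit_arg b = unit_arg b * (unit_arg (a - b) - 1).
  by rewrite mulrBr -unit_argD mulr1 subrKC.
rewrite Normc.normcM normc_unit_arg mul1r normc_unit_argB1 -sqrtr_sqr.
rewrite ler_sqrt ?sqr_ge0//; have := cos_ge_quadratic (a - b); lra.
Qed.

End UnitCircle.

(** * Exponential sums with slowly varying frequency *)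

Section KusminLandau.
Context {R : realType}.
Variables (c : R) (phi : nat -> R).
Hypothesis c0 : c != 0.
Let d j := phi j.+1 - phi j.
Let u j : R[i] := (unit_arg (c * d j) - 1)^-1.

(** With $e(x)$ for the unit complex number of argument $x$, one has
    $e(c\varphi_j) = u_j (e(c\varphi_{j+1}) - e(c\varphi_j))$. Summation by
    parts then leaves one boundary term, of size $2 / (|c| d_n)$, and the
    differences $u_j - u_{j+1}$. As $e$ is 1-Lipschitz and $|e(x) - 1| \ge
    |x|/2$, each difference is at most $4 (1/(|c| d_{j+1}) - 1/(|c| d_j))$, and
    these bounds telescope. *)
Lemma kusmin_landau m n : (m <= n)%N ->
  (forall j, (m <= j <= n)%N -> 0 < d j) ->
  (forall j, (m <= j < n)%N -> d j.+1 <= d j) ->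
  `|c| * d m <= 1 ->
  Normc.normc (\sum_(m <= j < n) unit_arg (c * phi j)) <= 6 / (`|c| * d n).
Proof.
have ac : 0 < `|c| by rewrite normr_gt0.
move=> mn d_gt0 d_noninc dm1.
have d_le j : (m <= j <= n)%N -> `|c| * d j <= 1.
  elim: j => [|j IH] /andP[mj jn].
    by move: mj dm1; rewrite leqn0 => /eqP ->.
  have [->//|mj'] := eqVneq j.+1 m.
  have mj1 : (m <= j)%N by move: mj; rewrite leq_eqVlt eq_sym (negbTE mj').
  apply: le_trans (IH _); last by rewrite mj1 ltnW.
  by rewrite ler_pM2l// d_noninc// mj1.
have ge_ j : (m <= j <= n)%N ->
    `|c| * d j / 2 <= Normc.normc (unit_arg (c * d j) - 1).
  move=> mjn; have dj := d_gt0 _ mjn.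
  have e : `|c| * d j = `|c * d j| by rewrite normrM (gtr0_norm dj).
  by rewrite e; apply: normc_unit_argB1_ge; rewrite -e d_le.
have cd_gt0 j : (m <= j <= n)%N -> 0 < `|c| * d j.
  by move=> mjn; rewrite mulr_gt0// d_gt0.
have n_gt0 j : (m <= j <= n)%N -> 0 < Normc.normc (unit_arg (c * d j) - 1).
  by move=> mjn; apply: lt_le_trans (ge_ _ mjn); rewrite divr_gt0// cd_gt0.
have neq0 j : (m <= j <= n)%N -> unit_arg (c * d j) - 1 != 0.
  by move=> /n_gt0; apply: contraTneq => ->; rewrite Normc.normc0 ltxx.
have u_le j : (m <= j <= n)%N -> Normc.normc (u j) <= 2 / (`|c| * d j).
  move=> mjn; rewrite Normc.normcV -invf_div lef_pV2 ?posrE ?n_gt0//.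
    exact: ge_.
  by rewrite divr_gt0// cd_gt0.
(* partial sum minus boundary term: its increments are the differences of u *)
pose W k := \sum_(m <= j < k) unit_arg (c * phi j) - u k * unit_arg (c * phi k).
have WS k : (m <= k < n)%N -> W k.+1 = W k + (u k - u k.+1) * unit_arg (c * phi k.+1).
  move=> /andP[mk kn]; rewrite /W big_nat_recr//=.
  have E : unit_arg (c * phi k) = u k * (unit_arg (c * phi k.+1) - unit_arg (c * phi k)).
    have -> : unit_arg (c * phi k.+1) = unit_arg (c * d k) * unit_arg (c * phi k).
      by rewrite -unit_argD -mulrDr subrK.
    rewrite -[X in _ * (_ - X)]mul1r -mulrBl mulrA mulVf ?mul1r//.
    by rewrite neq0// mk ltnW.
  by rewrite [X in _ + X - _]E; ring.
have W_le k : (m <= k <= n)%N -> Normc.normc (W k) <= 4 / (`|c| * d k).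
  elim: k => [|k IH] /andP[mk kn].
    move: mk; rewrite leqn0 => /eqP m0.
    rewrite /W m0 big_geq// sub0r normcN Normc.normcM normc_unit_arg mulr1.
    apply: (le_trans (u_le 0%N _)); first by rewrite m0.
    by rewrite ler_pM2r ?invr_gt0 ?cd_gt0 ?m0//; lra.
  have [mk1|mk1] := eqVneq m k.+1.
    rewrite /W -{1}mk1 big_geq// sub0r normcN Normc.normcM normc_unit_arg mulr1.
    apply: (le_trans (u_le _ _)); first by rewrite mk kn.
    by rewrite ler_pM2r ?invr_gt0 ?cd_gt0 ?mk//; lra.
  have mk' : (m <= k)%N by move: mk; rewrite leq_eqVlt (negbTE mk1).
  have ik : (m <= k <= n)%N by rewrite mk' ltnW.
  have ik1 : (m <= k.+1 <= n)%N by rewrite mk.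
  rewrite WS ?mk'//; apply: le_trans (le_normcD _ _) _.
  rewrite Normc.normcM normc_unit_arg mulr1.
  have -> : u k - u k.+1 = u k * u k.+1 * (unit_arg (c * d k.+1) - unit_arg (c * d k)).
    rewrite /u; field; first by rewrite !neq0.
  have e0 : Normc.normc (unit_arg (c * d k.+1) - unit_arg (c * d k)) <= `|c| * (d k - d k.+1).
    apply: le_trans (normc_unit_argB _ _) _.
    by rewrite -mulrBr normrM distrC [`|d k - _|]ger0_norm// subr_ge0 d_noninc// mk'.
  have nn (z : R[i]) : 0 <= Normc.normc z by case: z => x y; exact: sqrtr_ge0.
  rewrite !Normc.normcM.
  have b : Normc.normc (u k) * Normc.normc (u k.+1) *
      Normc.normc (unit_arg (c * d k.+1) - unit_arg (c * d k)) <=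
      2 / (`|c| * d k) * (2 / (`|c| * d k.+1)) * (`|c| * (d k - d k.+1)).
    by do ?apply: ler_pM => //; rewrite ?mulr_ge0 ?nn ?u_le.
  have p1 := d_gt0 _ ik; have p2 := d_gt0 _ ik1.
  apply: le_trans (lerD (IH ik) b) _.
  have -> // : 4 / (`|c| * d k) +
    2 / (`|c| * d k) * (2 / (`|c| * d k.+1)) * (`|c| * (d k - d k.+1)) =
    4 / (`|c| * d k.+1).
  by field; rewrite !gt_eqF.
have -> : \sum_(m <= j < n) unit_arg (c * phi j) =
    W n + u n * unit_arg (c * phi n) by rewrite subrK.
have inn : (m <= n <= n)%N by rewrite mn leqnn.
apply: le_trans (le_normcD _ _) _.
rewrite Normc.normcM normc_unit_arg mulr1.
apply: le_trans (lerD (W_le n inn) (u_le n inn)) _.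
by rewrite -mulrDl ler_pM2r ?invr_gt0 ?cd_gt0//; lra.
Qed.

End KusminLandau.

(** * The weights and the renewal tower *)

Section Tower.
Context {R : realType}.
Variable beta : R.
Hypothesis beta_gt0 : 0 < beta.
Hypothesis beta_lt : beta < 1 / 2.

Let beta_le1 : beta <= 1.
Proof. by apply: le_trans (ltW beta_lt) _; rewrite ler_pdivrMr// mul1r ler1n. Qed.

Lemma t_gt0 k : 0 < t_ beta k.+1.
Proof. exact: powR_gt0. Qed.

Lemma t_1 : t_ beta 1 = 1.
Proof. by rewrite /t_ powR1. Qed.

Lemma t_inv k : t_ beta k = (k%:R `^ beta)^-1.
Proof. by rewrite /t_ powRN. Qed.

Lemma t_decr i j : (i < j)%N -> t_ beta j.+1 < t_ beta i.+1.
Proof.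
move=> ij; rewrite !t_inv ltf_pV2 ?posrE ?powR_gt0//.
by apply: gt0_ltr_powR; rewrite ?nnegrE ?ltr_nat.
Qed.

Lemma t_noninc i j : (i <= j)%N -> t_ beta j.+1 <= t_ beta i.+1.
Proof. by rewrite leq_eqVlt => /predU1P[->//|/t_decr/ltW]. Qed.

Lemma t_le1 k : t_ beta k.+1 <= 1.
Proof. by rewrite -t_1 t_noninc. Qed.

Lemma a_gt0 k : 0 < a_ beta k.+1.
Proof. by rewrite /a_ subr_gt0 t_decr. Qed.

Lemma t_small (eps : R) : 0 < eps -> exists n, t_ beta n.+1 <= eps.
Proof.
move=> e0; pose w := eps^-1 `^ beta^-1.
have wE : w `^ beta = eps^-1.
  by rewrite -powRrM mulVf ?gt_eqF// powRr1// invr_ge0 ltW.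
exists (Num.truncn w); rewrite t_inv invf_ple ?posrE ?powR_gt0//.
rewrite -wE.
apply: ge0_ler_powR; rewrite ?nnegrE ?powR_ge0 ?(ltW beta_gt0)//.
by rewrite ltW// truncnS_gt.
Qed.

Lemma tau_0 : tau_ beta 0 = 0.
Proof. by rewrite /tau_ big_geq. Qed.

Lemma tauS k : tau_ beta k.+1 = tau_ beta k + t_ beta k.+1.
Proof. by rewrite /tau_ big_nat_recr. Qed.

Lemma tau_nondec i j : (i <= j)%N -> tau_ beta i <= tau_ beta j.
Proof.
elim: j => [|j IH]; first by rewrite leqn0 => /eqP ->.
rewrite leq_eqVlt => /predU1P[->//|ij]; apply: le_trans (IH ij) _.
by rewrite tauS lerDl ltW// t_gt0.
Qed.

Lemma tau_ge0 i : 0 <= tau_ beta i.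
Proof. by rewrite -tau_0 tau_nondec. Qed.

Lemma tau_unbounded (x : R) : exists n, x < tau_ beta n.
Proof.
(* the first N ^ 2 weights are all at least N^-1, because beta < 1 / 2 *)
have tau_ge k n : (k <= n.+1)%N -> k%:R * t_ beta n.+1 <= tau_ beta k.
  elim: k => [|k IH] kn; first by rewrite mul0r tau_0.
  rewrite tauS -natr1 mulrDl mul1r lerD ?IH//; first exact: ltnW.
  by rewrite t_noninc.
pose N := (Num.truncn x).+1.
exists (N ^ 2)%N.
apply: (@lt_le_trans _ _ N%:R); first by rewrite truncnS_gt.
have N2 : (N ^ 2)%N = (N ^ 2).-1.+1 by rewrite prednK// expn_gt0.
apply: le_trans (tau_ge (N ^ 2)%N (N ^ 2).-1 _); last by rewrite -N2.
rewrite -N2 t_inv ler_pdivlMr ?powR_gt0 ?ltr0n ?expn_gt0//.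
rewrite natrX expr2 ler_pM2l ?ltr0n//.
apply: (@le_trans _ _ ((N%:R ^+ 2) `^ (1 / 2))).
  by rewrite -expr2; apply: ler_powR; [rewrite -natrX ler1n expn_gt0|exact: ltW].
rewrite -[X in X `^ _]powR_mulrn// -powRrM.
by rewrite (_ : 2%:R * (1 / 2) = 1) ?powRr1//; field.
Qed.

(** The point of [L_ beta i] lying above [y] in the renewal tower: along the
    tower [Tbeta] only lowers [i] by one, so that an excursion away from
    $[0, 1)$ is determined by its height and by the single number [y]. *)
Definition tower i (y : R) : R := tau_ beta i + t_ beta i.+1 * y.

Lemma tower0 y : tower 0 y = y.
Proof. by rewrite /tower tau_0 t_1 add0r mul1r. Qed.

Lemma tower_step i y : tower i.+1 y - tower i y =
  (1 - y) * t_ beta i.+1 + y * t_ beta i.+2.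
Proof. by rewrite /tower tauS; ring. Qed.

Lemma waveE (omega x : R) : wave omega x = unit_arg (2 * pi * omega * x).
Proof.
rewrite /wave /cexp /unit_arg.
have -> : 2 * (pi : R)%:C * (0 +i* 1) * omega%:C * x%:C = 0 +i* (2 * pi * omega * x) :> R[i].
  rewrite -[2]/(2%:R) -(rmorph_nat (real_complex R)).
  by simpc.
by rewrite /= expR0 mul1r.
Qed.

(** A descent through floors $n - 1, \dots, m$ of the tower over [y] visits
    points with increments between $t_{j+2}$ and $t_{j+1}$, which decrease to 0
    like $j^{-\beta}$. The cancellation leaves only the inverse of the last
    increment, $O(n^\beta)$ out of up to $n$ terms, uniformly in [y] and [m];
    uniformity in [m] covers interrupted descents. *)
Lemma excursion_sum (omega : R) : omega != 0 -> exists2 C : R, 0 <= C &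
  forall (y : R) m n, 0 <= y <= 1 -> (m <= n)%N -> (0 < n)%N ->
  Normc.normc (\sum_(m <= j < n) wave omega (tower j y)) <= C / t_ beta n.
Proof.
move=> omega0.
pose c : R := 2 * pi * omega.
have c0 : c != 0 by rewrite !mulf_neq0// gt_eqF// pi_gt0.
have ac : 0 < `|c| by rewrite normr_gt0.
(* from floor J on, the phase increments are at most 1 *)
have /t_small[J tJ] : 0 < `|c|^-1 by rewrite invr_gt0.
exists (J%:R + 18 / `|c|); first by rewrite addr_ge0// divr_ge0.
move=> y m n /andP[y0 y1].
have tV k : 1 <= (t_ beta k.+1)^-1 by rewrite invf_ge1 ?t_le1 ?t_gt0.
have triv p q : Normc.normc (\sum_(p <= j < q) wave omega (tower j y)) <= (q - p)%:R.
  elim: q => [|q IH]; first by rewrite big_geq// Normc.normc0.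
  have [pq|qp] := leqP p q; last by rewrite big_geq// Normc.normc0.
  rewrite big_nat_recr//= subSn// -natr1; apply: le_trans (le_normcD _ _) _.
  by rewrite lerD// waveE normc_unit_arg.
have far p q : (J <= p <= q)%N -> (0 < q)%N ->
    Normc.normc (\sum_(p <= j < q) wave omega (tower j y)) <= 18 / `|c| / t_ beta q.
  move=> /andP[Jp pq] q0.
  under eq_bigr do rewrite waveE.
  have step_le j : tower j.+1 y - tower j y <= t_ beta j.+1.
    rewrite tower_step; have := t_noninc (leqnSn j).
    move=> h; have : y * t_ beta j.+2 <= y * t_ beta j.+1 by rewrite ler_wpM2l.
    lra.
  have step_ge j : t_ beta j.+2 <= tower j.+1 y - tower j y.
    rewrite tower_step; have := t_noninc (leqnSn j).
    move=> h; have : (1 - y) * t_ beta j.+2 <= (1 - y) * t_ beta j.+1.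
      by rewrite ler_wpM2l// subr_ge0.
    lra.
  have step_gt0 j : 0 < tower j.+1 y - tower j y.
    exact: lt_le_trans (t_gt0 _) (step_ge j).
  apply: le_trans (kusmin_landau (c := c) (phi := tower ^~ y) c0 pq _ _ _) _.
  - by move=> j _; exact: step_gt0.
  - move=> j _; exact: le_trans (step_le _) (step_ge _).
  - rewrite mulrC -ler_pdivlMr// div1r; apply: le_trans tJ.
    by apply: le_trans (step_le _) _; rewrite t_noninc.
  - have q3 : t_ beta q / 3 <= tower q.+1 y - tower q y.
      apply: le_trans (step_ge q).
      rewrite ler_pdivrMr// !t_inv [leRHS]mulrC ler_pdivlMr ?powR_gt0 ?ltr0n//.
      rewrite mulrC ler_pdivrMr ?powR_gt0 ?ltr0n//.
      apply: (@le_trans _ _ ((3 * q%:R) `^ beta)).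
        apply: ge0_ler_powR; rewrite ?nnegrE ?(ltW beta_gt0) ?mulr_ge0//.
        by rewrite -natrM ler_nat; lia.
      rewrite powRM// ler_pM2r ?powR_gt0 ?ltr0n//.
      by rewrite ler1_powR// ?ler1n.
    have tq : 0 < t_ beta q by case: (q) q0 => // q' _; exact: t_gt0.
    rewrite -mulrA -invfM ler_pdivrMr ?mulr_gt0//.
    rewrite mulrAC ler_pdivlMr ?mulr_gt0//.
    rewrite [6 * _]mulrCA [18 * _]mulrCA ler_pM2l//; lra.
move=> mn n0.
have tn : (t_ beta n)^-1 = (t_ beta n.-1.+1)^-1 by rewrite prednK.
have J0 : J%:R <= J%:R / t_ beta n by rewrite tn ler_peMr.
rewrite mulrDl.
have [nJ|Jn] := leqP n J.
  apply: le_trans (triv _ _) _; apply: ler_wpDr.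
    by rewrite tn !divr_ge0// ltW// t_gt0.
  by apply: le_trans J0; rewrite ler_nat (leq_trans (leq_subr _ _)).
have [mJ|Jm] := leqP m J.
  rewrite (big_cat_nat mJ (ltnW Jn))/=; apply: le_trans (le_normcD _ _) _.
  apply: lerD; last by rewrite far// leqnn ltnW.
  by apply: le_trans (triv _ _) _; apply: le_trans J0; rewrite ler_nat leq_subr.
rewrite ler_wpDl//; last by rewrite far// mn ltnW.
by rewrite tn divr_ge0// ltW// t_gt0.
Qed.
End Tower.

(** * The map in tower coordinates *)

Section Dynamics.
Context {R : realType}.
Variable beta : R.
Hypothesis beta_gt0 : 0 < beta.
Hypothesis beta_lt : beta < 1 / 2.

Lemma A_mem k (x : R) : A_ beta k x <-> t_ beta k.+1 < x <= t_ beta k.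
Proof. by rewrite /A_ /= in_itv. Qed.

Lemma L_mem k (x : R) : L_ beta k x <-> tau_ beta k <= x < tau_ beta k.+1.
Proof. by rewrite /L_ /= in_itv. Qed.

Lemma L_inj (x : R) i j : L_ beta i x -> L_ beta j x -> i = j.
Proof.
move=> /L_mem/andP[ix xi] /L_mem/andP[jx xj].
apply/eqP; rewrite eqn_leq; apply/andP; split; rewrite leqNgt; apply/negP => h.
- by have := lt_le_trans xj (le_trans (tau_nondec beta h) ix); rewrite ltxx.
- by have := lt_le_trans xi (le_trans (tau_nondec beta h) jx); rewrite ltxx.
Qed.

Lemma Lindex_eq k (x : R) : L_ beta k x -> Lindex beta x = k.
Proof. by move=> Lx; apply: xget_unique => // j; move/L_inj; apply. Qed.

Lemma A_cover (x : R) : 0 < x <= 1 -> exists k, A_ beta k.+1 x.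
Proof.
move=> /andP[x0 x1].
have [n tn] := t_small beta_gt0 (divr_gt0 x0 (ltr0n R 2)).
have ex : exists n, t_ beta n.+1 < x.
  by exists n; apply: le_lt_trans tn _; rewrite ltr_pdivrMr// ltr_pMr// ltr1n.
case: (ex_minnP ex) => -[|k].
  by rewrite t_1 ltNge x1.
move=> tk kmin; exists k; apply/A_mem; rewrite tk /=.
by rewrite leNgt; apply/negP => /kmin; rewrite ltnn.
Qed.

Lemma tower_L i (y : R) : 0 <= y < 1 -> L_ beta i (tower beta i y).
Proof.
move=> /andP[y0 y1]; apply/L_mem; rewrite /tower tauS.
by rewrite lerDl mulr_ge0 ?(ltW (t_gt0 _ _))//= ltrD2l gtr_pMr// t_gt0.
Qed.

Lemma tower_cover (x : R) : 0 <= x ->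
  exists i, exists2 y : R, 0 <= y < 1 & x = tower beta i y.
Proof.
move=> x0; have ex := tau_unbounded beta_gt0 beta_lt x.
case: (ex_minnP ex) => -[|k].
  by rewrite tau_0 ltNge x0.
move=> tk kmin; exists k, ((x - tau_ beta k) / t_ beta k.+1); last first.
  by rewrite /tower mulrC divfK ?gt_eqF ?t_gt0// subrKC.
rewrite divr_ge0 ?(ltW (t_gt0 _ _))//=.
  by rewrite ltr_pdivrMr ?t_gt0// mul1r ltrBlDl -tauS.
by rewrite subr_ge0 leNgt; apply/negP => /kmin; rewrite ltnn.
Qed.

(** The decreasing affine bijection from [A_ beta k.+1] onto $[0, 1)$. It is
    the first return map to $[0, 1)$ on that interval, the return time being
    $k + 1$. *)
Definition branch k (x : R) : R := (t_ beta k.+1 - x) / a_ beta k.+1.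

Lemma branch_mem k x : A_ beta k.+1 x <-> 0 <= branch k x < 1.
Proof.
have a0 := a_gt0 beta_gt0 k.
rewrite A_mem /branch ler_pdivlMr// mul0r ltr_pdivrMr// mul1r /a_ subr_ge0.
by rewrite ltrD2l ltrN2 andbC.
Qed.

(** On $[x, 1]$ only the first $k + 1$ terms of the density survive: the first
    $k$ intervals lie entirely to the right of [x] and contribute
    $t_1 + \dots + t_k$, the last one is cut at [x]. *)
Lemma Phi_branch k (x : R) : 0 < x -> A_ beta k.+1 x ->
  Phi beta x = tower beta k (branch k x).
Proof.
move=> x0 /A_mem/andP[tx xt].
have a0 j : 0 < a_ beta j.+1 by exact: a_gt0.
have c0 j : 0 <= t_ beta j.+1 / a_ beta j.+1.
  by rewrite divr_ge0// ltW// t_gt0.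
have mA j : measurable (A_ beta j : set (measurableTypeR R)) by exact: measurable_itv.
rewrite /Phi.
rewrite (_ : (\int[_]_(xi in _) _)%E = (\int[lebesgue_measure]_(xi in `[x, 1%R])
    \sum_(1 <= j < k.+2) ((t_ beta j / a_ beta j)%:E * (\1_(A_ beta j) xi)%:E))%E); last first.
  apply: eq_integral => xi; rewrite inE /= in_itv /= => /andP[xxi _].
  rewrite (nneseries_split 1 k.+1); last first.
    move=> [//|j] _; rewrite lee_fin mulr_ge0//.
  rewrite add1n eseries0 ?adde0//.
  move=> [//|j] kj _; rewrite indicE memNset ?mulr0//.
  move=> /A_mem/andP[_ h].
  have := lt_le_trans tx (le_trans xxi h).
  by rewrite ltNge t_noninc.
rewrite ge0_integral_sum//; last 2 first.
- move=> j; apply: measurable_funeM; apply/measurable_EFinP.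
  exact/measurable_indic.
- move=> [|j] xi _; last by rewrite mule_ge0// lee_fin.
  by rewrite /t_ powR0 ?mul0r ?mul0e// oppr_eq0 gt_eqF.
rewrite (_ : (\sum_(_ <= _ < _) _)%E =
  (\sum_(1 <= j < k.+2) (t_ beta j / a_ beta j)%:E * lebesgue_measure (A_ beta j `&` `[x, 1%R]))%E); last first.
  apply: eq_big_nat => -[//|j] _.
  rewrite ge0_integralZl_EFin//; last first.
    by apply/measurable_EFinP; exact/measurable_indic.
  by rewrite integral_indic.
rewrite big_nat_recr//=.
have -> : A_ beta k.+1 `&` `[x, 1%R] = `[x, t_ beta k.+1]%classic.
  apply/seteqP; split => y /=; rewrite !in_itv /=.
    by move=> [/andP[? ?] /andP[? ?]]; apply/andP.
  move=> /andP[xy yt]; split; apply/andP; split => //.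
  - exact: lt_le_trans xy.
  - by apply: le_trans yt _; exact: t_le1.
rewrite (_ : (\sum_(_ <= _ < _) _)%E = (tau_ beta k)%:E); last first.
  rewrite /tau_ -sumEFin; apply: eq_big_nat => -[//|j] /andP[_ jk].
  have -> : A_ beta j.+1 `&` `[x, 1%R] = `]t_ beta j.+2, t_ beta j.+1]%classic.
    apply/seteqP; split => y /=; rewrite !in_itv /=; first by move=> [].
    move=> /andP[ty yt]; split; first exact/andP.
    rewrite (le_trans yt (t_le1 _ _))// andbT.
    apply: le_trans (ltW ty); apply: le_trans xt _.
    exact: t_noninc.
  rewrite lebesgue_measure_itv/= lte_fin t_decr// -EFinB -EFinM.
  by rewrite divfK// gt_eqF.
rewrite lebesgue_measure_itv/= lte_fin.
have -> : (if (x < t_ beta k.+1)%R then (t_ beta k.+1)%:E - x%:E else 0)%E = (t_ beta k.+1 - x)%:E.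
  case: ltP => // h; have -> : x = t_ beta k.+1 by apply/eqP; rewrite eq_le xt h.
  by rewrite subrr.
rewrite -EFinM -EFinD /= /tower /branch.
by congr (_ + _); rewrite mulrAC mulrA.
Qed.

Variable v : R.

Lemma Tbeta_tower i (y : R) : 0 <= y < 1 ->
  Tbeta beta v (tower beta i.+1 y) = tower beta i y.
Proof.
move=> y01; have Ly := tower_L i.+1 y01.
have x0 : 0 < tower beta i.+1 y.
  move/L_mem: Ly => /andP[+ _]; apply: lt_le_trans.
  by rewrite tauS ltr_pwDr ?t_gt0// tau_ge0.
rewrite /Tbeta gt_eqF// (Lindex_eq Ly) /tower [_ + _ - _]addrAC subrr add0r.
rewrite addrC mulrA divfK// gt_eqF// t_gt0//.
Qed.

Lemma Tbeta_base k (x : R) : 0 < x < 1 -> A_ beta k.+1 x ->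
  Tbeta beta v x = tower beta k (branch k x).
Proof.
move=> /andP[x0 x1] Ax.
have Lx : L_ beta 0 x by apply/L_mem; rewrite tauS tau_0 add0r t_1 ltW.
by rewrite /Tbeta gt_eqF// (Lindex_eq Lx) (Phi_branch x0 Ax).
Qed.

(** From [x] in $(0, 1)$ the orbit jumps to this floor of the tower, and then
    descends one floor per step until it is back in $[0, 1)$. *)
Definition height (x : R) : nat := xget 0%N [set k | A_ beta k.+1 x].

Definition return_map (x : R) : R := branch (height x) x.

Lemma height_mem (x : R) : 0 < x <= 1 -> A_ beta (height x).+1 x.
Proof. by move=> /A_cover; exact: xgetPex. Qed.

Lemma return_map_mem (x : R) : 0 < x <= 1 -> 0 <= return_map x < 1.
Proof. by move=> x01; apply/branch_mem; exact: height_mem. Qed.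

End Dynamics.

(** * Birkhoff sums along excursions *)

Section Excursions.
Context {R : realType}.
Variable beta : R.
Hypothesis beta_gt0 : 0 < beta.
Variable v : R.
Notation T := (Tbeta beta v).
Notation G := (return_map beta).

Lemma iter_tower i j (y : R) : 0 <= y < 1 -> (j <= i)%N ->
  iter j T (tower beta i y) = tower beta (i - j) y.
Proof.
move=> y01; elim: j => [|j IH] ji; first by rewrite subn0.
by rewrite iterS IH ?(ltnW ji)// -(subnSK ji) Tbeta_tower.
Qed.

Lemma iter_excursion i (y : R) : 0 < y < 1 ->
  iter i.+1 T (tower beta i y) = tower beta (height beta y) (G y).
Proof.
move=> y01; have /andP[y0 y1] := y01.
rewrite iterS iter_tower ?leqnn ?subnn ?(ltW y0)// tower0.
by apply: Tbeta_base => //; apply: height_mem => //; rewrite y0 ltW.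
Qed.

(** The orbit under the return map stays in the open interval. This excludes
    the orbits that reach 0, where the value of the map is arbitrary. *)
Definition regular (y : R) := forall j, 0 < iter j G y < 1.

Lemma regular_return y : regular y -> regular (G y).
Proof. by move=> ry j; rewrite -iterSr. Qed.

(** The orbit of [tower beta i y] is cut after each visit to $[0, 1)$. The
    first piece starts on floor [i], each later one on the floor given by the
    height of the preceding visit; a piece that starts on floor $h$ has
    $h + 1$ points. *)
Definition excursion_length i (y : R) l : nat :=
  if l is l'.+1 then (height beta (iter l' G y)).+1 else i.+1.

Lemma excursion_lengthS i y l :
  excursion_length (height beta y) (G y) l = excursion_length i y l.+1.
Proof. by case: l => //= l; rewrite -iterSr. Qed.

Variables (f : R -> R[i]) (C : R).
Hypothesis C_ge0 : 0 <= C.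
Hypothesis excursion_le : forall (y : R) m n, 0 <= y <= 1 -> (m <= n)%N -> (0 < n)%N ->
  Normc.normc (\sum_(m <= j < n) f (tower beta j y)) <= C / t_ beta n.

Lemma partial_excursion i n (y : R) : 0 <= y < 1 -> (n <= i.+1)%N ->
  \sum_(0 <= j < n) f (iter j T (tower beta i y)) =
  \sum_((i.+1 - n)%N <= j < i.+1) f (tower beta j y).
Proof.
move=> y01 ni; rewrite big_nat_rev/= add0n -{1}[(i.+1 - n)%N]add0n big_addn subKn//.
apply: eq_big_nat => j /= jn; rewrite iter_tower//; last by lia.
by congr (f (tower beta _ y)); lia.
Qed.

(** Time [n] falls within the first [N] pieces: every completed piece is
    bounded by its excursion sum, and so is the interrupted one. *)
Lemma birkhoff_sum_le N i y n : regular y ->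
  (n <= \sum_(0 <= l < N) excursion_length i y l)%N ->
  Normc.normc (\sum_(0 <= j < n) f (iter j T (tower beta i y))) <=
  \sum_(0 <= l < N) C / t_ beta (excursion_length i y l).
Proof.
elim: N i y n => [|N IH] i y n ry.
  by rewrite big_nil leqn0 => /eqP ->; rewrite !big_nil Normc.normc0.
have y01 := ry 0%N; have /andP[/= y0 y1] := y01.
have summand_ge0 l : 0 <= C / t_ beta (excursion_length i y l).
  by rewrite divr_ge0//; case: l => [|l]; rewrite ltW// t_gt0.
rewrite !big_nat_recl//= => nN.
have [ni|ni] := leqP n i.+1.
  rewrite partial_excursion ?(ltW y0)//; apply: ler_wpDr.
    by apply: sumr_ge0 => l _; exact: (summand_ge0 l.+1).
  by apply: excursion_le => //; rewrite ?(ltW y0) ?(ltW y1)// leq_subr.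
rewrite (big_cat_nat (leq0n i.+1) (ltnW ni))/=.
apply: le_trans (le_normcD _ _) _; apply: lerD.
  rewrite partial_excursion ?(ltW y0)// subnn.
  by apply: excursion_le => //; rewrite (ltW y0) (ltW y1).
rewrite -{1}[i.+1]add0n big_addn.
under eq_bigr do rewrite iterD iter_excursion//.
rewrite -(eq_bigr _ (fun l _ => congr1 (fun h => C / t_ beta h) (excursion_lengthS i y l))).
apply: IH; first exact: regular_return.
rewrite (eq_bigr _ (fun l _ => excursion_lengthS i y l)).
by rewrite leq_subLR.
Qed.

(** Along a time scale indexed by [m] there are about $Q^m$ excursions. A lower
    bound $w^{-m}$ on the visits to $[0, 1)$ caps each excursion sum by $C w^m$,
    because a visit $x$ to $A_k$ satisfies $1/t_k \le 1/x$; so the Birkhoff sum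
    is $O((Q w)^m)$. A single excursion of length $D^m$ makes the elapsed time
    at least $D^m$, which is exponentially larger. *)
Lemma birkhoff_avg_cvg0 (Q D : nat) (w : R) i (y : R) : regular y ->
  (0 < Q)%N -> 1 <= w -> Q%:R * w < D%:R ->
  (exists m0, forall m, (m0 <= m)%N -> forall j, (j < Q ^ m.+1)%N ->
     w ^- m <= iter j G y) ->
  (exists m0, forall m, (m0 <= m)%N -> exists2 j, (j < Q ^ m)%N &
     (D ^ m <= (height beta (iter j G y)).+1)%N) ->
  birkhoff_avg T f (tower beta i y) n @[n --> \oo] --> (0 : R[i]^o).
Proof.
move=> ry Q0 w1 QwD [m1 lb] [m2 long].
have w0 : 0 < w by exact: lt_le_trans w1.
have Q1 : 1 <= Q%:R :> R by rewrite ler1n.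
have D0 : 0 < D%:R :> R by apply: le_lt_trans QwD; rewrite mulr_ge0// ltW.
pose S m := (\sum_(0 <= l < (Q ^ m).+1) excursion_length i y l)%N.
have S_ge m : (m2 <= m)%N -> (D ^ m <= S m)%N.
  move=> /long[j jQ] h; apply: leq_trans h _; rewrite /S.
  by rewrite (@big_cat_nat _ _ _ j.+2)//= big_nat_recr//= addnAC leq_addl.
have D1 : (1 < D)%N.
  rewrite -(ltr_nat R); apply: le_lt_trans QwD.
  by rewrite -[leLHS]mulr1 ler_pM.
(* K * rho ^+ m bounds the Birkhoff average while S m <= n < S m.+1 *)
pose K := C / t_ beta i.+1 + C * Q%:R.
pose rho := Q%:R * w / D%:R.
have rho_ge0 : 0 <= rho by rewrite divr_ge0 ?mulr_ge0// ltW.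
have rho1 : rho < 1 by rewrite ltr_pdivrMr// mul1r.
have avg_le m n : (m1 <= m)%N -> (m2 <= m)%N -> (S m <= n < S m.+1)%N ->
    Normc.normc (\sum_(0 <= j < n) f (iter j T (tower beta i y))) <=
    n%:R * (K * rho ^+ m).
  move=> m1m m2m /andP[Sn nS].
  apply: le_trans (birkhoff_sum_le ry (ltnW nS)) _.
  have Dn : D%:R ^+ m <= n%:R :> R.
    by rewrite -natrX ler_nat (leq_trans (S_ge m m2m)).
  have K0 : 0 <= K by rewrite addr_ge0 ?mulr_ge0// invr_ge0 ltW// t_gt0.
  have Qw1 : 1 <= (Q%:R * w) ^+ m.
    by rewrite exprn_ege1// -[leLHS]mulr1 ler_pM.
  apply: (@le_trans _ _ (K * (Q%:R * w) ^+ m)); last first.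
    have -> : K * (Q%:R * w) ^+ m = D%:R ^+ m * (K * rho ^+ m).
      by rewrite /rho expr_div_n mulrCA [_ ^+ m * (_ / _)]mulrC divfK// expf_neq0// gt_eqF.
    by rewrite ler_wpM2r// mulr_ge0// exprn_ge0.
  rewrite big_nat_recl//= /K mulrDl; apply: lerD.
    by rewrite ler_peMr// divr_ge0// ltW// t_gt0.
  apply: (@le_trans _ _ (\sum_(0 <= l < Q ^ m.+1) C * w ^+ m)).
    rewrite big_nat_cond [leRHS]big_nat_cond; apply: ler_sum => l /andP[/andP[_ lQ] _].
    rewrite ler_wpM2l// -[leRHS]invrK lef_pV2 ?posrE ?t_gt0 ?invr_gt0 ?exprn_gt0//.
    apply: le_trans (lb m m1m l lQ) _.
    have /andP[r0 r1] := ry l.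
    have /(height_mem beta_gt0)/A_mem/andP[] // : 0 < iter l G y <= 1.
    by rewrite r0 ltW.
  rewrite sumr_const_nat subn0 -[leLHS]mulr_natr natrX exprSr exprMn.
  by rewrite le_eqVlt; apply/orP; left; apply/eqP; ring.
apply/cvgrPdist_lt => -[e e'].
rewrite ltcE /= => /andP[/eqP -> e0].
have [m3 rhoK] : exists m3, forall m, (m3 <= m)%N -> K * rho ^+ m < e.
  have : (fun m => K * rho ^+ m) @ \oo --> (0 : R).
    by apply: cvg_geometric; rewrite ger0_norm.
  move=> /cvgrPdist_lt/(_ _ e0)[m3 _ h]; exists m3 => m /h.
  by rewrite sub0r normrN; apply: le_lt_trans; exact: ler_norm.
(* the scale m = M + k of a given time n is found by minimality of k *)
pose M := maxn m1 (maxn m2 m3).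
have [m1M m2M m3M] : [/\ (m1 <= M)%N, (m2 <= M)%N & (m3 <= M)%N].
  by rewrite /M !leq_max !leqnn !orbT.
have le_addM p k : (p <= M)%N -> (p <= M + k)%N.
  by move=> pM; rewrite (leq_trans pM)// leq_addr.
exists (S M).+1 => // n /= Sn.
have ex : exists k, (n < S (M + k)%N)%N.
  exists n; apply: (@leq_trans (D ^ (M + n))%N); last exact/S_ge/le_addM.
  by apply: leq_ltn_trans (leq_addl M n) _; exact: ltn_expl.
case: (ex_minnP ex) => -[|k].
  by rewrite addn0 ltnNge (ltnW Sn).
move=> nSk kmin.
have Skn : (S (M + k) <= n)%N.
  by rewrite leqNgt; apply/negP => /kmin; rewrite ltnn.
have n0 : 0 < n%:R :> R by rewrite ltr0n (leq_ltn_trans _ Sn).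
have := @avg_le (M + k)%N n; rewrite -addnS Skn nSk => /(_ _ _ isT) h.
rewrite sub0r normrN norm_normc complexr0 ltcR.
rewrite /birkhoff_avg Normc.normcM Normc.normcV.
have -> : Normc.normc (n%:R : R[i]) = n%:R.
  rewrite -(rmorph_nat (real_complex R)) /= expr0n /= addr0 sqrtr_sqr.
  exact/ger0_norm/ltW.
rewrite ltr_pdivrMl//; apply: le_lt_trans (h _ _) _; rewrite ?le_addM//.
by rewrite ltr_pM2l// rhoK// le_addM.
Qed.

End Excursions.

(** * Lebesgue measure under affine maps, and a Borel-Cantelli lemma *)

Section MeasureTools.
Context {R : realType}.
Notation mu := (@lebesgue_measure R).
Implicit Types X : set (measurableTypeR R).

Definition affine (p q x : R) : R := p * x + q.

Lemma measurable_affine p q :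
  measurable_fun [set: measurableTypeR R] (affine p q : _ -> measurableTypeR R).
Proof. by apply: measurable_funD => //; exact: measurable_funM. Qed.

Lemma measurable_preimage_affine p q X : measurable X ->
  measurable (affine p q @^-1` X : set (measurableTypeR R)).
Proof.
by move=> mX; rewrite -[X in measurable X]setTI; exact: measurable_affine.
Qed.

Lemma lebesgue_measure_preimage_affine (p q : R) X : p != 0 -> measurable X ->
  (`|p|%:E * mu (affine p q @^-1` X))%E = mu X.
Proof.
move=> p0 mX.
pose g : measurableTypeR R -> measurableTypeR R := affine p q.
have mg : measurable_fun setT g by exact: measurable_affine.
pose nu : {measure set (measurableTypeR R) -> \bar R} :=
  measure_function_pushforward__canonical__measure_function_Measure mu mg.
apply/esym/(@lebesgue_measure_unique R (mscale `|p|%:nng nu)) => //.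
move=> _ [[a b]] _ <-; rewrite /=.
have -> : mscale `|p|%:nng nu `]a, b]%classic = (`|p|%:E * mu (g @^-1` `]a, b]))%E by [].
have sub x : affine p q x - q = p * x by rewrite /affine addrK.
case: (ltgtP p 0) p0 => // pneg _.
- have -> : g @^-1` `]a, b] = `[(b - q) / p, (a - q) / p[%classic.
    apply/seteqP; split => x /=; rewrite !in_itv /= /g.
      by rewrite ler_ndivrMr// ltr_ndivlMr// ![_ * p]mulrC -sub lerD2r ltrD2r andbC.
    by rewrite ler_ndivrMr// ltr_ndivlMr// ![_ * p]mulrC -sub lerD2r ltrD2r andbC.
  rewrite !lebesgue_measure_itv/= !lte_fin ltr_ndivrMr// divfK ?lt_eqF// ltrD2r.
  case: ifPn => _; last by rewrite mule0.
  rewrite -!EFinB -EFinM ltr0_norm//; congr _%:E; field.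
  by rewrite lt_eqF.
- have -> : g @^-1` `]a, b] = `](a - q) / p, (b - q) / p]%classic.
    apply/seteqP; split => x /=; rewrite !in_itv /= /g.
      by rewrite ler_pdivlMr// ltr_pdivrMr// ![_ * p]mulrC -sub lerD2r ltrD2r.
    by rewrite ler_pdivlMr// ltr_pdivrMr// ![_ * p]mulrC -sub lerD2r ltrD2r.
  rewrite !lebesgue_measure_itv/= !lte_fin ltr_pdivrMr// divfK ?gt_eqF// ltrD2r.
  case: ifPn => _; last by rewrite mule0.
  rewrite -!EFinB -EFinM gtr0_norm//; congr _%:E; field.
  by rewrite gt_eqF.
Qed.

Lemma negligible_preimage_affine (p q : R) (X : set R) : p != 0 ->
  mu.-negligible X -> mu.-negligible (affine p q @^-1` X).
Proof.
move=> p0 [N [mN N0 XN]]; exists (affine p q @^-1` N); split.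
- exact: measurable_preimage_affine.
- have := lebesgue_measure_preimage_affine q p0 mN; rewrite N0 => /eqP.
  by rewrite mule_eq0 eqe normr_eq0 (negbTE p0)/= => /eqP.
- exact: preimage_subset.
Qed.

Lemma lim_sup_set_geometric (F : (set (measurableTypeR R))^nat) (c rho : R) :
  0 <= c -> 0 <= rho < 1 -> (forall m, measurable (F m)) ->
  (forall m, (mu (F m) <= (c * rho ^+ m)%:E)%E) ->
  mu.-negligible (lim_sup_set F).
Proof.
move=> c0 /andP[rho0 rho1] mF Fle.
exists (lim_sup_set F); split => //.
  by apply: bigcap_measurable => // k _; exact: bigcup_measurable.
apply: lim_sup_set_cvg0 => //.
apply: (@le_lt_trans _ _ (c / (1 - rho))%:E); last exact: ltry.
apply: lime_le; first exact: is_cvg_nneseries.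
apply: nearW => n; apply: (@le_trans _ _ (\sum_(0 <= i < n) (c * rho ^+ i)%:E)%E).
  by apply: lee_sum => i _; exact: Fle.
rewrite sumEFin lee_fin.
have r1 : 1 - rho != 0 by rewrite subr_eq0 gt_eqF.
have -> : \sum_(0 <= i < n) c * rho ^+ i = c * (1 - rho ^+ n) / (1 - rho).
  elim: n => [|n IH]; first by rewrite big_nil expr0 subrr mulr0 mul0r.
  by rewrite big_nat_recr//= IH exprS; field.
rewrite ler_pM2r ?invr_gt0 ?subr_gt0//.
by rewrite ler_piMr// gerBl exprn_ge0.
Qed.

Lemma not_lim_sup_set (T : Type) (F : (set T)^nat) x : ~ lim_sup_set F x ->
  exists m0, forall m, (m0 <= m)%N -> ~ F m x.
Proof.
move=> nF; apply: contrapT => h; apply: nF => n _ /=; apply: contrapT => h'.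
by apply: h; exists n => m nm Fm; apply: h'; exists m.
Qed.

End MeasureTools.

(** * Statistics of the return map *)

Section ReturnMap.
Context {R : realType}.
Variable beta : R.
Hypothesis beta_gt0 : 0 < beta.
Notation mu := (@lebesgue_measure R).
Notation G := (return_map beta).
Implicit Types B : set (measurableTypeR R).

(** The preimage of [B] under the return map, keeping only the points whose
    excursion has its height in [K]. *)
Definition pull (K : set nat) B : set (measurableTypeR R) :=
  \bigcup_(k in K) (branch beta k @^-1` (B `&` `[0, 1[)).

Lemma branch_affine k :
  branch beta k = affine (- (a_ beta k.+1)^-1) (t_ beta k.+1 / a_ beta k.+1).
Proof. by apply/funext => x; rewrite /branch /affine; ring. Qed.

Lemma measurable_branch k B : measurable B ->
  measurable (branch beta k @^-1` (B `&` `[0, 1[) : set (measurableTypeR R)).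
Proof.
move=> mB; rewrite branch_affine; apply: measurable_preimage_affine.
by apply: measurableI => //; exact: measurable_itv.
Qed.

Lemma measurable_pull K B : measurable B -> measurable (pull K B).
Proof. by move=> mB; apply: bigcup_measurable => k _; exact: measurable_branch. Qed.

Lemma measure_branch k B : measurable B ->
  (mu (branch beta k @^-1` (B `&` `[0%R, 1%R[)) <= (a_ beta k.+1)%:E * mu B)%E.
Proof.
move=> mB; have a0 := a_gt0 beta_gt0 k.
have mB1 : measurable (B `&` `[0, 1[ : set (measurableTypeR R)).
  by apply: measurableI => //; exact: measurable_itv.
have p0 : - (a_ beta k.+1)^-1 != 0 by rewrite oppr_eq0 invr_eq0 gt_eqF.
have := lebesgue_measure_preimage_affine (t_ beta k.+1 / a_ beta k.+1) p0 mB1.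
rewrite -branch_affine normrN gtr0_norm ?invr_gt0// => e.
have le : (mu (B `&` `[0%R, 1%R[) <= mu B)%E by apply: le_measure; rewrite ?inE.
rewrite -e in le.
have := lee_wpmul2l _ le => /(_ (a_ beta k.+1)%:E); rewrite lee_fin ltW// => /(_ isT).
by rewrite muleA -EFinM mulfV ?gt_eqF// mul1e.
Qed.

Lemma sum_a n : \sum_(0 <= k < n) a_ beta k.+1 = 1 - t_ beta n.+1.
Proof.
elim: n => [|n IH]; first by rewrite big_nil t_1 subrr.
by rewrite big_nat_recr//= IH /a_; ring.
Qed.

Lemma measure_pull_lt n B : measurable B ->
  (mu (pull `I_n B) <= (1 - t_ beta n.+1)%:E * mu B)%E.
Proof.
move=> mB; rewrite /pull bigcup_mkord -sum_a.
have h : forall k, (k < n)%N -> measurable (branch beta k @^-1` (B `&` `[0, 1[) : set (measurableTypeR R)).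
  by move=> k _; exact: measurable_branch.
apply: (le_trans (Boole_inequality mu h)).
rewrite -sumEFin ge0_sume_distrl ?big_mkord; last first.
  by move=> k _; rewrite lee_fin ltW// a_gt0.
by apply: lee_sum => k _; exact: measure_branch.
Qed.

(** The branches of the return map are affine bijections onto $[0, 1)$ whose
    domains have total length 1; hence the return map preserves Lebesgue
    measure. *)
Lemma measure_pull B : measurable B -> (mu (pull setT B) <= mu B)%E.
Proof.
move=> mB; apply: le_trans (generalized_Boole_inequality mu (fun k => measurable_branch k mB) _) _.
  by apply: bigcup_measurable => k _; exact: measurable_branch.
apply: lime_le; first exact: is_cvg_nneseries.
apply: nearW => n; apply: (@le_trans _ _ ((\sum_(0 <= k < n) a_ beta k.+1)%:E * mu B)%E).
  rewrite -sumEFin ge0_sume_distrl.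
    by apply: lee_sum => k _; exact: measure_branch.
  by move=> k _; rewrite lee_fin ltW// a_gt0.
by rewrite -[leRHS]mul1e lee_wpmul2r// lee_fin sum_a gerBl ltW// t_gt0.
Qed.

Lemma measurable_iter_pull N K B : measurable B -> measurable (iter N (pull K) B).
Proof. by move=> mB; elim: N => //= N IH; exact: measurable_pull. Qed.

Lemma measure_iter_pull N B : measurable B ->
  (mu (iter N (pull setT) B) <= mu B)%E.
Proof.
move=> mB; elim: N => //= N IH; apply: le_trans IH.
by apply: measure_pull; exact: measurable_iter_pull.
Qed.

(** The heights along an orbit of the return map behave like independent
    variables of tail $P(h \ge n) = t_{n+1}$. *)
Lemma measure_iter_pull_lt n N B : measurable B ->
  (mu (iter N (pull `I_n) B) <= ((1 - t_ beta n.+1) ^+ N)%:E * mu B)%E.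
Proof.
move=> mB; elim: N => [|N IH]; first by rewrite /= mul1e.
have t1 : 0 <= 1 - t_ beta n.+1 by rewrite subr_ge0 t_le1.
apply: le_trans (measure_pull_lt _ (measurable_iter_pull _ _ mB)) _.
by rewrite exprS EFinM -muleA lee_wpmul2l.
Qed.

(** Positivity is asked only before time [N], so that the lemma also applies
    to the first passage of an orbit through 0, at time [N]. *)
Lemma iter_pull_mem N (K : set nat) B (y : R) :
  (forall j, (j < N)%N -> 0 < iter j G y < 1 /\ K (height beta (iter j G y))) ->
  B (iter N G y) -> iter N (pull K) B y.
Proof.
elim: N y => [//|N IH] y Hy BN.
have /= [/andP[y0 y1] Ky] := Hy 0%N (ltn0Sn N).
exists (height beta y) => //=; split.
  by apply: IH; [move=> j jN; rewrite -iterSr; exact: Hy|rewrite -iterSr].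
by rewrite in_itv /=; apply: return_map_mem => //; rewrite y0 ltW.
Qed.

Lemma regular_of_iter_pull (y : R) : 0 <= y < 1 ->
  (forall j, ~ iter j (pull setT) [set 0] y) -> regular beta y.
Proof.
move=> /andP[y0 y1] nZ.
have reg n j : (j <= n)%N -> 0 < iter j G y < 1.
  elim: n j => [|n IH] j.
    rewrite leqn0 => /eqP ->; rewrite y1 andbT lt_neqAle y0 andbT eq_sym.
    by apply/negP => /eqP; exact: (nZ 0%N).
  rewrite leq_eqVlt => /predU1P[->|]; last exact: IH.
  have /andP[g0 g1] := IH _ (leqnn n).
  have /andP[h0 h1] : 0 <= iter n.+1 G y < 1.
    by rewrite iterS; apply: return_map_mem => //; rewrite g0 ltW.
  rewrite h1 andbT lt_neqAle h0 andbT eq_sym; apply/negP => /eqP e.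
  by apply: (nZ n.+1); apply: iter_pull_mem => // i i_n; split=> //; exact: IH.
by move=> j; exact: (reg j).
Qed.

Lemma negligible_not_regular :
  mu.-negligible [set y : R | 0 <= y < 1 /\ ~ regular beta y].
Proof.
apply: (@negligibleS _ _ _ _ (\bigcup_j iter j (pull setT) [set 0])).
  move=> y [y01 nr]; apply: contrapT => h; apply: nr.
  by apply: regular_of_iter_pull => // j Zj; apply: h; exists j.
apply: negligible_bigcup => j; exists (iter j (pull setT) [set 0]); split => //.
  exact: measurable_iter_pull.
apply/eqP; rewrite -measure_le0; apply: le_trans (measure_iter_pull _ _) _ => //.
by rewrite lebesgue_measure_set1.
Qed.

Lemma bernoulli_inv (t : R) N : 0 <= t <= 1 -> (1 - t) ^+ N * (1 + N%:R * t) <= 1.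
Proof.
move=> /andP[t0 t1]; elim: N => [|N IH]; first by rewrite mul0r addr0 mulr1.
apply: le_trans IH; rewrite exprSr -mulrA ler_wpM2l ?exprn_ge0 ?subr_ge0//.
rewrite -natr1 -subr_ge0.
have -> : 1 + N%:R * t - (1 - t) * (1 + (N%:R + 1) * t) = (N%:R + 1) * t ^+ 2 by ring.
by rewrite mulr_ge0// ?addr_ge0// sqr_ge0.
Qed.

(** By invariance of the measure, each visit lies below $w^{-m}$ with
    probability at most $w^{-m}$. The union bound over $Q^{m+1}$ visits gives
    $Q (Q / w)^m$, which is summable. *)
Lemma negligible_small_returns (Q : nat) (w : R) : Q%:R < w -> (0 < Q)%N ->
  mu.-negligible [set y : R | regular beta y /\
    ~ exists m0, forall m, (m0 <= m)%N -> forall j, (j < Q ^ m.+1)%N ->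
        w ^- m <= iter j G y].
Proof.
move=> Qw Q0; have Qr : 0 < Q%:R :> R by rewrite ltr0n.
have w0 : 0 < w by exact: lt_trans Qw.
pose F m : set (measurableTypeR R) :=
  \big[setU/set0]_(j < Q ^ m.+1) iter j (pull setT) `[0, w ^- m]%classic.
have mI m : measurable (`[0, w ^- m]%classic : set (measurableTypeR R)).
  exact: measurable_itv.
apply: (@negligibleS _ _ _ _ (lim_sup_set F)).
  move=> y [ry ne]; apply: contrapT => nL; apply: ne.
  have [m0 nF] := not_lim_sup_set nL.
  exists m0 => m /nF nFm j jQ; rewrite leNgt; apply/negP => lt; apply: nFm.
  rewrite /F -bigcup_mkord; exists j => //=.
  apply: iter_pull_mem; first by move=> i _; split.
  by rewrite /= in_itv /= ltW ?(ltW lt)//; have /andP[] := ry j.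
apply: (@lim_sup_set_geometric _ _ Q%:R (Q%:R / w)) => //.
- by rewrite divr_ge0 ?ltW//= ltr_pdivrMr// mul1r.
- by move=> m; apply: bigsetU_measurable => j _; exact: measurable_iter_pull.
move=> m.
have h : forall j, (j < Q ^ m.+1)%N -> measurable (iter j (pull setT) `[0, w ^- m]%classic).
  by move=> j _; exact: measurable_iter_pull.
apply: (le_trans (Boole_inequality mu h)).
apply: (@le_trans _ _ (\sum_(j < Q ^ m.+1) (w ^- m)%:E)%E).
  apply: lee_sum => j _; apply: le_trans (measure_iter_pull _ (mI m)) _.
  rewrite lebesgue_measure_itv/= lte_fin invr_gt0 exprn_gt0//.
  by rewrite -EFinB subr0.
rewrite sumEFin lee_fin sumr_const card_ord -[leLHS]mulr_natl natrX exprS.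
by rewrite expr_div_n mulrA.
Qed.

(** Failure at scale [m] has probability $(1 - t_{D^m})^{Q^m} \le 1 / (Q^m
    t_{D^m}) = (D^\beta / Q)^m$, by independence of the heights and Bernoulli's
    inequality; this is summable. *)
Lemma negligible_short_excursions (Q D : nat) : (0 < D)%N ->
  D%:R `^ beta < Q%:R ->
  mu.-negligible [set y : R | regular beta y /\
    ~ exists m0, forall m, (m0 <= m)%N -> exists2 j, (j < Q ^ m)%N &
        (D ^ m <= (height beta (iter j G y)).+1)%N].
Proof.
move=> D0 DQ.
have Qr : 0 < Q%:R :> R by apply: le_lt_trans DQ; exact: powR_ge0.
have Dr : 0 < D%:R `^ beta by rewrite powR_gt0// ltr0n.
have mI : measurable (`[0, 1[%classic : set (measurableTypeR R)).
  exact: measurable_itv.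
pose F m : set (measurableTypeR R) :=
  iter (Q ^ m) (pull `I_((D ^ m).-1)) `[0, 1[%classic.
apply: (@negligibleS _ _ _ _ (lim_sup_set F)).
  move=> y [ry ne]; apply: contrapT => nL; apply: ne.
  have [m0 nF] := not_lim_sup_set nL.
  exists m0 => m /nF nFm; apply: contrapT => h; apply: nFm.
  apply: iter_pull_mem; last first.
    by rewrite /= in_itv /=; have /andP[/ltW-> ->] := ry (Q ^ m)%N.
  move=> j jQ; split => //=; rewrite ltnNge; apply/negP => hD; apply: h.
  by exists j => //; lia.
apply: (@lim_sup_set_geometric _ _ 1 (D%:R `^ beta / Q%:R)) => //.
- by rewrite divr_ge0 ?ltW//= ltr_pdivrMr// mul1r.
- by move=> m; exact: measurable_iter_pull.
move=> m; apply: le_trans (measure_iter_pull_lt _ _ mI) _.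
rewrite lebesgue_measure_itv/= lte_fin ltr01 oppr0 adde0 mule1 lee_fin.
rewrite prednK ?expn_gt0 ?D0// mul1r expr_div_n.
have tE : t_ beta (D ^ m) = (D%:R `^ beta) ^- m.
  by rewrite t_inv natrX -powR_mulrn// -powRrM mulrC powRrM powR_mulrn.
have Dm : (D ^ m = (D ^ m).-1.+1)%N by rewrite prednK// expn_gt0 D0.
have t0 : 0 < t_ beta (D ^ m) by rewrite Dm t_gt0.
have t1 : t_ beta (D ^ m) <= 1 by rewrite Dm t_le1.
have N0 : 0 <= (1 - t_ beta (D ^ m)) ^+ (Q ^ m).
  by rewrite exprn_ge0// subr_ge0.
have := @bernoulli_inv (t_ beta (D ^ m)) (Q ^ m)%N.
rewrite (ltW t0) t1 => /(_ isT); apply: contraTT; rewrite -!ltNge.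
rewrite ltr_pdivrMr ?exprn_gt0// -[X in X < _]invrK -tE -div1r ltr_pdivrMr// => lt.
apply: lt_le_trans lt _; rewrite -mulrA ler_wpM2l// natrX.
by rewrite lerDr.
Qed.

End ReturnMap.

(** * Almost everywhere convergence *)

(** Since $1/\beta > 2$, there is room between $Q^2$ and $Q^{1/\beta}$ for large
    [Q]: take $D = Q^2 + 1$, and $w$ slightly above $Q$ so that
    $Q w = Q^2 + 1/2$. *)
Lemma scales_exist (R : realType) (beta : R) : 0 < beta -> beta < 1 / 2 ->
  exists (Q D : nat) (w : R), [/\ (0 < Q)%N,
    D%:R `^ beta < Q%:R, 1 <= w, Q%:R < w & Q%:R * w < D%:R].
Proof.
move=> beta_gt0 beta_lt.
have b2 : 0 < 1 - 2 * beta by rewrite subr_gt0 mulrC -ltr_pdivlMr.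
pose z : R := 2 `^ (1 - 2 * beta)^-1.
pose Q := (Num.truncn z).+1.
have zQ : z < Q%:R by exact: truncnS_gt.
have Q0 : 0 < Q%:R :> R by rewrite ltr0n.
have Q1 : 1 <= Q%:R :> R by rewrite ler1n.
exists Q, (Q ^ 2).+1, (Q%:R + (2 * Q%:R)^-1); split => //.
- apply: (@le_lt_trans _ _ ((2 * Q%:R ^+ 2) `^ beta)).
    apply: ge0_ler_powR; rewrite ?nnegrE ?(ltW beta_gt0) ?mulr_ge0 ?sqr_ge0//.
    by rewrite -natrX -natrM ler_nat; lia.
  rewrite powRM ?sqr_ge0//.
  have -> : (Q%:R ^+ 2) `^ beta = Q%:R `^ (2 * beta) by rewrite powRrM powR_mulrn.
  have Qsplit : Q%:R = Q%:R `^ (1 - 2 * beta) * Q%:R `^ (2 * beta) :> R.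
    by rewrite -powRD ?subrK ?powRr1 ?(ltW Q0)// (gt_eqF Q0) implybT.
  rewrite [ltRHS]Qsplit ltr_pM2r ?powR_gt0//; apply: (@le_lt_trans _ _ 2).
    rewrite ler1_powR ?ler1n//; apply: le_trans (ltW beta_lt) _.
    by rewrite ler_pdivrMr// mul1r ler1n.
  have zE : z `^ (1 - 2 * beta) = 2.
    by rewrite /z -powRrM mulVf ?powRr1// gt_eqF.
  by rewrite -[ltLHS]zE gt0_ltr_powR// nnegrE ?powR_ge0// ltW.
- by rewrite ler_wpDr// invr_ge0 mulr_ge0// ltW.
- by rewrite ltrDl invr_gt0 mulr_gt0.
- have -> : (Q ^ 2).+1%:R = Q%:R ^+ 2 + 1 :> R by rewrite -[LHS]natr1 natrX.
  rewrite mulrDr -expr2 ltrD2l.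
  rewrite invfM mulrCA mulfV ?gt_eqF// mulr1.
  by rewrite invf_lt1// ltr1n.
Qed.

Theorem proposition3p1 (R : realType) (omega beta v : R)
    (omega_neq0 : omega != 0) (beta_gt0 : 0 < beta) (beta_lt : beta < 1 / 2)
    (v_ge0 : 0 <= v) :
  {ae @lebesgue_measure R, forall x : R, 0 <= x ->
    birkhoff_avg (Tbeta beta v) (wave omega) x n @[n --> \oo] --> (0 : R[i]^o)}.
Proof.
have [Q [D [w [Q0 DQ w1 Qw QwD]]]] := scales_exist beta_gt0 beta_lt.
have [C C0 exc] := excursion_sum beta_gt0 beta_lt omega_neq0.
pose N := [set y : R | 0 <= y < 1 /\ ~ regular beta y] `|`
  ([set y : R | regular beta y /\
    ~ exists m0, forall m, (m0 <= m)%N -> forall j, (j < Q ^ m.+1)%N ->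
        w ^- m <= iter j (return_map beta) y] `|`
  [set y : R | regular beta y /\
    ~ exists m0, forall m, (m0 <= m)%N -> exists2 j, (j < Q ^ m)%N &
        (D ^ m <= (height beta (iter j (return_map beta) y)).+1)%N]).
have N0 : (@lebesgue_measure R).-negligible N.
  apply: negligibleU; first exact: negligible_not_regular.
  apply: negligibleU; first exact: negligible_small_returns.
  apply: negligible_short_excursions => //.
  by rewrite -(ltr_nat R); apply: le_lt_trans QwD; rewrite mulr_ge0// (le_trans _ w1).
(* the inverse of tower beta i *)
pose base i (x : R) := affine (t_ beta i.+1)^-1 (- (tau_ beta i / t_ beta i.+1)) x.
apply: (@negligibleS _ _ _ lebesgue_measure (\bigcup_i (base i @^-1` N))); last first.
  apply: negligible_bigcup => i; apply: negligible_preimage_affine => //.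
  by rewrite invr_eq0 gt_eqF// t_gt0.
move=> x /= /not_implyP[x0 ncvg].
have [i [y y01 xE]] := tower_cover beta_gt0 beta_lt x0.
exists i => //=.
have -> : base i x = y.
  by rewrite xE /base /affine /tower; field; rewrite gt_eqF// t_gt0.
apply: contrapT => nN; apply: ncvg; rewrite xE.
have ry : regular beta y by apply: contrapT => nr; apply: nN; left.
apply: (birkhoff_avg_cvg0 beta_gt0 v C0 exc i ry Q0 w1 QwD).
- by apply: contrapT => h; apply: nN; right; left.
- by apply: contrapT => h; apply: nN; right; right.
Qed.
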